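(* Let $\mathbb{M}=(\mathbb{X},R,V)$ be an extremally disconnected model with $\mathbb{X}=(X,\tau)$ and valuation $V:\mathrm{Prop}\to\mathrm{Clp}(\mathbb{X})$. For every clean formula $\varphi$ of the modal $\mu$-calculus and every $x\in X$, the following are equivalent: (i) $x\in[\![\varphi]\!]_V$; (ii) $\exists$ has a winning strategy at position $(\varphi,x)$ in the evaluation game $\mathcal{E}(\varphi,\mathbb{M})$.
   Context: An extremally disconnected model $\mathbb{M}=(\mathbb{X},R,V)$: $\mathbb{X}=(X,\tau)$ is an extremally disconnected Stone space (closure of every open set is open), so the clopen sets $\mathrm{Clp}(\mathbb{X})$ form a complete lattice with joins $\mathrm{Cl}(\bigcup U_i)$ and meets $\mathrm{Int}(\bigcap U_i)$; $R\subseteq X\times X$ has $R(x)$ closed for each $x$ and $\{x\mid R(x)\cap U\neq\emptyset\}$ clopen for each clopen $U$; $V$ maps propositional variables to clopen sets. Formulas (negation normal form): $p,\neg p,\varphi\wedge\varphi,\varphi\vee\varphi,\bot,\top,\Diamond\varphi,\Box\varphi,\mu p.\varphi,\nu p.\varphi$, where $p$ does not occur under a negation in $\mu p.\varphi,\nu p.\varphi$. Clopen semantics: $[\![p]\!]_V=V(p)$, $[\![\neg p]\!]_V=X\setminus V(p)$, $\wedge,\vee$ as intersection, union, $[\![\bot]\!]_V=\emptyset$, $[\![\top]\!]_V=X$, $[\![\Diamond\psi]\!]_V=\{x\mid R(x)\cap[\![\psi]\!]_V\neq\emptyset\}$, $[\![\Box\psi]\!]_V=\{x\mid R(x)\subseteq[\![\psi]\!]_V\}$,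 and $[\![\mu p.\psi]\!]_V$, $[\![\nu p.\psi]\!]_V$ are the least and greatest fixpoints in the complete lattice $\mathrm{Clp}(\mathbb{X})$ of the monotone map $U\mapsto[\![\psi]\!]_{V[p\mapsto U]}$ on $\mathrm{Clp}(\mathbb{X})$. A formula is clean if no two distinct fixpoint operators bind the same variable and no variable occurs both free and bound; for bound $p$, $\varphi@p=\eta p.\psi$ is the unique subformula binding $p$; $p\le_\varphi q$ iff $\varphi@p$ is a subformula of $\varphi@q$. Evaluation game $\mathcal{E}(\varphi,\mathbb{M})$ (two players $\exists,\forall$; positions $(\psi,x)$ with $\psi$ a subformula of $\varphi$, $x\in X$, and $(p,U)$ with $p$ bound, $U$ clopen): at $(p,x)$ with $p$ free, the position is owned by $\exists$ with no moves if $x\notin V(p)$ and by $\forall$ with no moves if $x\in V(p)$; at $(\neg p,x)$ with $p$ free, owned by $\forall$ with no moves if $x\notin V(p)$, by $\exists$ with no moves if $x\in V(p)$; $(\bot,x)$ is a stuck position of $\exists$ and $(\top,x)$ of $\forall$; at $(\psi_1\wedge\psi_2,x)$ $\forall$ chooses $(\psi_i,x)$; at $(\psi_1\vee\psi_2,x)$ $\exists$ chooses $(\psi_i,x)$; at $(\Diamond\psi,x)$ $\exists$ chooses $(\psi,x')$ with $xRx'$; at $(\Box\psi,x)$ $\forall$ chooses $(\psi,x')$ with $xRx'$; at $(\eta p.\psi,x)$ the play moves to $(\psi,x)$; at $(p,x)$ with $p$ bound and $\varphi@p=\mu p.\psi$, $\forall$ chooses $(p,U)$ with $U$ clopen, $x\in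 U$, after which $\exists$ chooses $(\psi,x')$ with $x'\in U$; at $(p,x)$ with $p$ bound and $\varphi@p=\nu p.\psi$, $\exists$ chooses $(p,U)$ with $U$ clopen, $x\in U$, after which $\forall$ chooses $(\psi,x')$ with $x'\in U$. A player who must move but has no legal move loses; an infinite play $\pi$ is won by $\exists$ iff the $\le_\varphi$-maximal bound variable occurring infinitely often in $\pi$ is bound by $\nu$. *)

(* Defs.v *)
From mathcomp Require Import all_boot.
From mathcomp Require Import boolp classical_sets topology.

Set Implicit Arguments.
Unset Strict Implicit.
Unset Printing Implicit Defensive.

Local Open Scope classical_set_scope.

Definition stone_space (X : topologicalType) :=
  [/\ compact [set: X], hausdorff_space X & totally_disconnected [set: X]].

Definition extremally_disconnected (X : topologicalType) :=
  forall U : set X, open U -> open (closure U).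

Record edModel (P : eqType) := EdModel {
  carrier :> topologicalType;
  acc : carrier -> set carrier;
  valuation : P -> set carrier;
  carrier_stone : stone_space carrier;
  carrier_ed : extremally_disconnected carrier;
  acc_closed : forall x, closed (acc x);
  acc_clopen : forall U : set carrier, clopen U ->
    clopen [set x | acc x `&` U !=set0];
  valuation_clopen : forall p, clopen (valuation p) }.

Arguments acc {P} e.
Arguments valuation {P} e.

Inductive fixop := Mu | Nu.

Inductive form (P : Type) :=
| Var of P
| NVar of P
| And of form P & form P
| Or of form P & form P
| Bot
| Top
| Dia of form P
| Box of form P
| Fix of fixop & P & form P.

Arguments Bot {P}.
Arguments Top {P}.

Section Syntax.
Variable P : eqType.
Implicit Types (phi psi chi : form P) (p q : P).

Fixpoint occurs_negated p phi : bool :=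
  match phi with
  | NVar q => q == p
  | And a b | Or a b => occurs_negated p a || occurs_negated p b
  | Dia a | Box a | Fix _ _ a => occurs_negated p a
  | Var _ | Bot | Top => false
  end.

(* [form] is the raw syntax; [wf_form] is the proviso on fixpoint formulas. *)
Fixpoint wf_form phi : bool :=
  match phi with
  | Fix _ p a => ~~ occurs_negated p a && wf_form a
  | And a b | Or a b => wf_form a && wf_form b
  | Dia a | Box a => wf_form a
  | Var _ | NVar _ | Bot | Top => true
  end.

Fixpoint free_vars phi : seq P :=
  match phi with
  | Var p | NVar p => [:: p]
  | And a b | Or a b => free_vars a ++ free_vars b
  | Dia a | Box a => free_vars a
  | Fix _ p a => [seq q <- free_vars a | q != p]
  | Bot | Top => [::]
  end.

(* One entry per occurrence of a fixpoint operator. *)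
Fixpoint bound_vars phi : seq P :=
  match phi with
  | And a b | Or a b => bound_vars a ++ bound_vars b
  | Dia a | Box a => bound_vars a
  | Fix _ p a => p :: bound_vars a
  | Var _ | NVar _ | Bot | Top => [::]
  end.

Definition clean phi : bool :=
  uniq (bound_vars phi) && ~~ has [in free_vars phi] (bound_vars phi).

Fixpoint subform chi phi : Prop :=
  chi = phi \/
  match phi with
  | And a b | Or a b => subform chi a \/ subform chi b
  | Dia a | Box a | Fix _ _ a => subform chi a
  | Var _ | NVar _ | Bot | Top => False
  end.

(* [binder phi p = Some (eta, psi)] encodes phi@p = eta p. psi, and
   [binder phi p = None] says that p is not bound in phi; see [binderP]. *)
Fixpoint binder phi p : option (fixop * form P) :=
  match phi with
  | Fix eta q a => if q == p then Some (eta, a) else binder a p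
  | And a b | Or a b => if binder a p is Some r then Some r else binder b p
  | Dia a | Box a => binder a p
  | Var _ | NVar _ | Bot | Top => None
  end.

Definition dep_le phi p q : Prop :=
  match binder phi p, binder phi q with
  | Some (eta, a), Some (theta, b) => subform (Fix eta p a) (Fix theta q b)
  | _, _ => False
  end.

Lemma subform_refl phi : subform phi phi.
Proof. by case: phi => *; left. Qed.

Lemma subform_trans chi psi phi :
  subform chi psi -> subform psi phi -> subform chi phi.
Proof.
move=> cp; elim: phi => [p|p|a IHa b IHb|a IHa b IHb|||a IHa|a IHa|e p a IHa] /=;
  case=> [e0|]; try by move: cp; rewrite e0.
all: by try case; tauto.
Qed.

Lemma binder_subform phi p eta psi :
  binder phi p = Some (eta, psi) -> subform (Fix eta p psi) phi.
Proof.
elim: phi => [q|q|a IHa b IHb|a IHa b IHb|||a IHa|a IHa|e q a IHa] //=.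
- by case: binder IHa => [r IHa /IHa|_ /IHb]; right; [left|right].
- by case: binder IHa => [r IHa /IHa|_ /IHb]; right; [left|right].
- by move/IHa; right.
- by move/IHa; right.
- by case: eqP => [-> [-> ->]|_ /IHa]; [left|right].
Qed.

Lemma subform_bound phi p eta psi :
  subform (Fix eta p psi) phi -> p \in bound_vars phi.
Proof.
elim: phi => [q|q|a IHa b IHb|a IHa b IHb|||a IHa|a IHa|e q a IHa] /=;
  case=> [//|]; rewrite ?mem_cat ?inE.
- by [].
- by [].
- by case=> [/IHa|/IHb] ->; rewrite ?orbT.
- by case=> [/IHa|/IHb] ->; rewrite ?orbT.
- by [].
- by [].
- exact: IHa.
- exact: IHa.
- by case=> _ -> _; rewrite eqxx.
- by move/IHa ->; rewrite orbT.
Qed.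

Lemma binder_bound phi p : isSome (binder phi p) = (p \in bound_vars phi).
Proof.
elim: phi => [q|q|a IHa b IHb|a IHa b IHb|||a IHa|a IHa|e q a IHa] //=;
  rewrite ?mem_cat ?inE -?IHa -?IHb //; try by case: (binder a p).
by rewrite eq_sym; case: eqP.
Qed.

Lemma binder_pair a b p (eta : fixop) psi :
  (uniq (bound_vars a) ->
    binder a p = Some (eta, psi) <-> subform (Fix eta p psi) a) ->
  (uniq (bound_vars b) ->
    binder b p = Some (eta, psi) <-> subform (Fix eta p psi) b) ->
  uniq (bound_vars a ++ bound_vars b) ->
  (if binder a p is Some r then Some r else binder b p) = Some (eta, psi) <->
  subform (Fix eta p psi) a \/ subform (Fix eta p psi) b.
Proof.
rewrite cat_uniq => IHa IHb /and3P[/IHa Ha /hasPn ab /IHb Hb].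
rewrite -Ha -Hb; case E: (binder a p) => [r|]; split; try tauto; try by case.
case=> // /binder_subform /subform_bound /ab /negP[].
by rewrite -binder_bound E.
Qed.

Lemma binderP phi p eta psi : clean phi ->
  binder phi p = Some (eta, psi) <-> subform (Fix eta p psi) phi.
Proof.
case/andP=> + _; elim: phi => [q|q|a IHa b IHb|a IHa b IHb|||a IHa|a IHa|e q a IHa] /=.
- by move=> _; split=> // -[].
- by move=> _; split=> // -[].
- by move=> /(binder_pair IHa IHb) ->; split=> [|[]//]; right.
- by move=> /(binder_pair IHa IHb) ->; split=> [|[]//]; right.
- by move=> _; split=> // -[].
- by move=> _; split=> // -[].
- by move=> /IHa ->; split=> [|[]//]; right.
- by move=> /IHa ->; split=> [|[]//]; right.
- case/andP=> qa /IHa H; case: eqP => [qp|qp].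
    split=> [[-> ->]|[[-> _ ->]//|/subform_bound]]; first by left; rewrite qp.
    by rewrite -qp (negbTE qa).
  by rewrite H; split=> [|[[_ /esym]|]//]; right.
Qed.

End Syntax.

Section Semantics.
Variables (P : eqType) (M : edModel P).
Implicit Types (F : set M -> set M) (U W : set M).

Definition is_clopen_lfp F U :=
  [/\ clopen U, F U = U & forall W, clopen W -> F W = W -> U `<=` W].

Definition is_clopen_gfp F U :=
  [/\ clopen U, F U = U & forall W, clopen W -> F W = W -> W `<=` U].

(* The least (greatest) fixpoint of F in the lattice of clopen sets. The
   default value [set0] of [xget] is only taken when there is none, which does
   not occur for the monotone maps given by formulas. *)
Definition clopen_fix (eta : fixop) F : set M :=
  xget set0 (match eta with Mu => is_clopen_lfp F | Nu => is_clopen_gfp F end).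

Fixpoint sem (phi : form P) (V : P -> set M) : set M :=
  match phi with
  | Var p => V p
  | NVar p => ~` V p
  | And a b => sem a V `&` sem b V
  | Or a b => sem a V `|` sem b V
  | Bot => set0
  | Top => setT
  | Dia a => [set x | acc M x `&` sem a V !=set0]
  | Box a => [set x | acc M x `<=` sem a V]
  | Fix eta p a => clopen_fix eta (fun U => sem a [eta V with p |-> U])
  end.

End Semantics.

Inductive player := Eloise | Abelard.

(* [eloise_wins] is the winning condition on infinite plays. *)
Record game := Game {
  pos : Type;
  owner : pos -> player;
  moves : pos -> set pos;
  eloise_wins : set (nat -> pos) }.

Section Strategies.
Variables (G : game) (z : pos G).
Implicit Types (pi : nat -> pos G) (sigma : seq (pos G) -> pos G) (n : nat).

Definition stuck (v : pos G) := moves v = set0.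

(* [pi 0, .., pi n] is a partial play from z. *)
Definition play pi n :=
  pi 0 = z /\ forall i, i < n -> moves (pi i) (pi i.+1).

(* Strategies may depend on the whole history of the play. *)
Definition guided sigma pi n :=
  play pi n /\
  forall i, i < n -> owner (pi i) = Eloise -> pi i.+1 = sigma (mkseq pi i.+1).

Definition eloise_strategy sigma := forall pi n,
  play pi n -> owner (pi n) = Eloise -> ~ stuck (pi n) ->
  moves (pi n) (sigma (mkseq pi n.+1)).

Definition winning_strategy sigma :=
  [/\ eloise_strategy sigma,
      forall pi n, guided sigma pi n -> stuck (pi n) -> owner (pi n) = Abelard
    & forall pi, (forall n, guided sigma pi n) -> eloise_wins pi].

Definition eloise_has_winning_strategy := exists sigma, winning_strategy sigma.

End Strategies.

Section EvaluationGame.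
Variables (P : eqType) (phi : form P) (M : edModel P).

(* [At psi x] is (psi, x) and [Nbh p U] is (p, U). *)
Inductive eval_pos :=
| At of form P & M
| Nbh of P & set M.

(* The positions of the game; [legal_posM] below shows that a play starting at
   one of them never leaves them, so [eval_pos] need not be cut down. *)
Definition legal_pos (z : eval_pos) : Prop :=
  match z with
  | At psi _ => subform psi phi
  | Nbh p U => p \in bound_vars phi /\ clopen U
  end.

(* At (eta p. psi, x) there is a single move, so the owner is immaterial. *)
Definition eval_owner (z : eval_pos) : player :=
  match z with
  | At (Var p) x =>
      match binder phi p with
      | Some (Mu, _) => Abelard
      | Some (Nu, _) => Eloise
      | None => if x \in valuation M p then Abelard else Eloise
      end
  | At (NVar p) x => if x \in valuation M p then Eloise else Abelard
  | At Bot _ | At (Or _ _) _ | At (Dia _) _ | At (Fix _ _ _) _ => Eloise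
  | At Top _ | At (And _ _) _ | At (Box _) _ => Abelard
  | Nbh p _ => if binder phi p is Some (Nu, _) then Abelard else Eloise
  end.

Definition eval_moves (z : eval_pos) : set eval_pos :=
  match z with
  | At (Var p) x =>
      if binder phi p is Some _
      then [set w | exists U, [/\ clopen U, U x & w = Nbh p U]]
      else set0
  | At (And a b) x | At (Or a b) x => [set At a x; At b x]
  | At (Dia a) x | At (Box a) x => At a @` acc M x
  | At (Fix _ _ a) x => [set At a x]
  | At (NVar _) _ | At Bot _ | At Top _ => set0
  | Nbh p U => if binder phi p is Some (_, a) then At a @` U else set0
  end.

Definition occurs_at (p : P) (z : eval_pos) : Prop :=
  match z with
  | At (Var q) _ | Nbh q _ => q = p
  | _ => False
  end.

Definition bound_inf_often (pi : nat -> eval_pos) (p : P) : Prop :=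
  p \in bound_vars phi /\ forall n, exists2 m, n <= m & occurs_at p (pi m).

Definition eval_wins (pi : nat -> eval_pos) : Prop :=
  exists p, [/\ bound_inf_often pi p,
    forall q, bound_inf_often pi q -> dep_le phi p q -> q = p
    & exists a, binder phi p = Some (Nu, a)].

Definition eval_game : game :=
  {| pos := eval_pos; owner := eval_owner;
     moves := eval_moves; eloise_wins := eval_wins |}.

Lemma legal_posM z w : legal_pos z -> eval_moves z w -> legal_pos w.
Proof.
have sub a b : subform b phi -> subform a b -> subform a phi.
  by move=> bphi ab; exact: subform_trans ab bphi.
case: z => [[p|p|a b|a b|||a|a|e p a] x|p U] //=.
- move=> _; case E: (binder phi p) => [r|//] [U [cU _ ->]] /=.
  by rewrite -binder_bound E.
- by move=> /sub s [] -> /=; apply: s; right; [left|right]; exact: subform_refl.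
- by move=> /sub s [] -> /=; apply: s; right; [left|right]; exact: subform_refl.
- by move=> /sub s [y _ <-] /=; apply: s; right; exact: subform_refl.
- by move=> /sub s [y _ <-] /=; apply: s; right; exact: subform_refl.
- by move=> /sub s -> /=; apply: s; right; exact: subform_refl.
- move=> _; case E: (binder phi p) => [[e a]|//] [y _ <-] /=.
  by apply: sub (binder_subform E) _; right; exact: subform_refl.
Qed.

End EvaluationGame.

(* Main.v *)
Require Import Defs.
From mathcomp Require Import all_boot.
From mathcomp Require Import boolp classical_sets topology.

(** A formula that is true at [x] yields a strategy for Eloise that remembers,
  for every enclosing fixpoint variable, a clopen value: the greatest fixpoint
  for a nu-variable, an approximant [closure (\bigcup F (...))] of the least
  fixpoint for a mu-variable. At [(p, y)] with [p] a nu-variable she plays the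
  stored value itself. At [(p, y)] with [p] a mu-variable, [y] lies in the closure of
  a union of earlier approximants, so every open neighbourhood chosen by Abelard
  meets one of them, and the stage stored for [p] drops. Stages are well-founded,
  hence the dominant variable of an infinite play is a nu-variable.

  Conversely, if [x] is not in the meaning of [phi], it is in the meaning of the
  dual formula under the complemented valuation, and Eloise's strategy there
  serves Abelard in the original game. Playing it against a winning strategy of
  Eloise gives an infinite play won by both, which is impossible because the
  dominant variable is unique. *)

Set Implicit Arguments.
Unset Strict Implicit.
Unset Printing Implicit Defensive.

Local Open Scope classical_set_scope.

(** * Fixpoints in the lattice of clopen sets *)

Section ClopenFixpoints.
Variables (P : eqType) (M : edModel P).
Implicit Types (F : set M -> set M) (U W : set M) (V : P -> set M).

Lemma clopen_setC U : clopen U -> clopen (~` U).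
Proof. by case=> oU cU; split; [exact: closed_openC|exact: open_closedC]. Qed.

Lemma clopen_closure_open U : open U -> clopen (closure U).
Proof. by move=> oU; split; [exact: (@carrier_ed _ M)|exact: closed_closure]. Qed.

Definition clopen_endo F := forall U, clopen U -> clopen (F U).

Definition clopen_mono F :=
  forall U W, clopen U -> clopen W -> U `<=` W -> F U `<=` F W.

Definition conjugate F U := ~` F (~` U).

Lemma conjugateK F : conjugate (conjugate F) = F.
Proof. by apply: funext => U; rewrite /conjugate !setCK. Qed.

Lemma clopen_endo_conjugate F : clopen_endo F -> clopen_endo (conjugate F).
Proof. by move=> Fc U cU; apply/clopen_setC/Fc/clopen_setC. Qed.

Lemma clopen_mono_conjugate F : clopen_mono F -> clopen_mono (conjugate F).
Proof.
by move=> Fm U W cU cW UW; apply/subsetC/Fm; [exact: clopen_setC..|exact: subsetC].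
Qed.

(** Knaster-Tarski: the complement of [closure B] is the meet, among clopen sets, of all clopen
    prefixpoints, and extremal disconnectedness makes it clopen. *)
Lemma clopen_lfp_exists F : clopen_endo F -> clopen_mono F ->
  exists2 U, is_clopen_lfp F U & forall W, clopen W -> F W `<=` W -> U `<=` W.
Proof.
move=> Fc Fm.
pose B := \bigcup_(W in [set W | clopen W /\ F W `<=` W]) ~` W.
have oB : open B by apply: bigcup_open => W [[_ cW] _]; exact: closed_openC.
have cU : clopen (~` closure B) by apply/clopen_setC/clopen_closure_open.
have least W : clopen W -> F W `<=` W -> ~` closure B `<=` W.
  move=> cW FW y /= nBy; apply: contrapT => nWy; apply: nBy.
  by apply: subset_closure; exists W.
have pre : F (~` closure B) `<=` ~` closure B.
  move=> y Fy By; have [oF _] := Fc _ cU.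
  (* An open set meeting [closure B] already meets [B], so it contains a point outside some
     prefixpoint [W]. *)
  have [u [[W [cW FW] nWu] Fu]] := By _ (open_nbhs_nbhs (conj oF Fy)).
  exact/nWu/FW/(Fm (~` closure B) W cU cW (least _ cW FW)).
exists (~` closure B) => //; split=> // [|W cW FW].
  rewrite eqEsubset; split=> //; apply: least; first exact: Fc.
  exact: Fm (Fc _ cU) cU pre.
by apply: least => //; rewrite FW.
Qed.

(** [xget] has a witness by [clopen_lfp_exists]; lying below that witness upgrades minimality from
    fixpoints to prefixpoints. *)
Lemma clopen_muP F : clopen_endo F -> clopen_mono F ->
  [/\ clopen (clopen_fix Mu F), F (clopen_fix Mu F) = clopen_fix Mu F &
      forall W, clopen W -> F W `<=` W -> clopen_fix Mu F `<=` W].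
Proof.
move=> Fc Fm; have [U lU least] := clopen_lfp_exists Fc Fm.
have [cm Fx lm] : is_clopen_lfp F (clopen_fix Mu F).
  by apply: (@xgetPex _ set0 (is_clopen_lfp F)); exists U.
split=> // W cW FW; apply: subset_trans (least _ cW FW).
by case: lU => cU FU _; exact: lm.
Qed.

Lemma is_clopen_gfpC F U :
  is_clopen_lfp (conjugate F) U -> is_clopen_gfp F (~` U).
Proof.
case=> cU FU lU; split; first exact: clopen_setC.
  by rewrite -{2}FU /conjugate setCK.
move=> W cW FW; apply: subsetCr; apply: lU; first exact: clopen_setC.
by rewrite /conjugate setCK FW.
Qed.

(** Complementation turns the least fixpoint of the conjugate into a greatest fixpoint of [F], and
    greatest fixpoints are unique. This brings facts on [Nu] back to [Mu]. *)
Lemma clopen_nuE F : clopen_endo F -> clopen_mono F ->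
  clopen_fix Nu F = ~` clopen_fix Mu (conjugate F).
Proof.
move=> Fc Fm; have [cm Fx lm] :=
  clopen_muP (clopen_endo_conjugate Fc) (clopen_mono_conjugate Fm).
have g : is_clopen_gfp F (~` clopen_fix Mu (conjugate F)).
  by apply: is_clopen_gfpC; split=> // W cW FW; apply: lm => //; rewrite FW.
have [cn Fn gn] : is_clopen_gfp F (clopen_fix Nu F).
  by apply: (@xgetPex _ set0 (is_clopen_gfp F)); eexists; exact: g.
by case: g => cg Fg gg; rewrite eqEsubset; split; [exact: gg|exact: gn].
Qed.

Lemma clopen_nuP F : clopen_endo F -> clopen_mono F ->
  [/\ clopen (clopen_fix Nu F), F (clopen_fix Nu F) = clopen_fix Nu F &
      forall W, clopen W -> W `<=` F W -> W `<=` clopen_fix Nu F].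
Proof.
move=> Fc Fm; have [cm Fx lm] :=
  clopen_muP (clopen_endo_conjugate Fc) (clopen_mono_conjugate Fm).
rewrite clopen_nuE //; split; first exact: clopen_setC.
  by rewrite -[X in _ = ~` X]Fx /conjugate setCK.
move=> W cW FW; apply: subsetCr; apply: lm; first exact: clopen_setC.
by rewrite /conjugate setCK; exact: subsetC.
Qed.

Lemma clopen_fix_clopen eta F : clopen_endo F -> clopen_mono F ->
  clopen (clopen_fix eta F).
Proof.
by move=> Fc Fm; case: eta; [case: (clopen_muP Fc Fm)|case: (clopen_nuP Fc Fm)].
Qed.

Lemma clopen_fix_le eta F G : clopen_endo F -> clopen_mono F ->
  clopen_endo G -> clopen_mono G -> (forall U, clopen U -> F U `<=` G U) ->
  clopen_fix eta F `<=` clopen_fix eta G.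
Proof.
move=> Fc Fm Gc Gm FG; case: eta.
  have [cG eG _] := clopen_muP Gc Gm; have [_ _] := clopen_muP Fc Fm.
  by apply=> //; rewrite -{2}eG; exact: FG.
have [cF eF _] := clopen_nuP Fc Fm; have [_ _] := clopen_nuP Gc Gm.
by apply=> //; rewrite -{1}eF; exact: FG.
Qed.

(** Agreement on clopen sets is what [sem_dual] can supply, since its induction hypothesis asks for
    a clopen valuation. *)
Lemma eq_clopen_fix eta F G : (forall U, clopen U -> F U = G U) ->
  clopen_fix eta F = clopen_fix eta G.
Proof.
have sub (F1 F2 : set M -> set M) : (forall U, clopen U -> F1 U = F2 U) ->
    is_clopen_lfp F1 `<=` is_clopen_lfp F2 /\
    is_clopen_gfp F1 `<=` is_clopen_gfp F2.
  move=> e12; split=> U [cU fU lU]; split; rewrite -?e12 // => W cW;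
    rewrite -e12 //; exact: lU.
move=> FG; have [l1 g1] := sub F G FG; have [|l2 g2] := sub G F.
  by move=> U cU; rewrite FG.
rewrite /clopen_fix; congr xget.
by case: eta; apply/seteqP; split.
Qed.

Definition clopen_env V := forall p, clopen (V p).

Lemma clopen_env_upd V p U : clopen_env V -> clopen U ->
  clopen_env [eta V with p |-> U].
Proof. by move=> cV cU q /=; case: eqP. Qed.

(** One induction for both claims: at a fixpoint formula, clopenness of the value rests on
    monotonicity of the body. Agreement on negated variables handles [NVar], and the proviso on
    binders preserves it when the bound variable is updated. *)
Lemma sem_clopen_mono (phi : form P) : wf_form phi ->
  (forall V, clopen_env V -> clopen (sem phi V)) /\
  (forall V V', clopen_env V -> clopen_env V' -> (forall p, V p `<=` V' p) ->
     (forall p, occurs_negated p phi -> V p = V' p) ->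
     sem phi V `<=` sem phi V').
Proof.
elim: phi => [p|p|a IHa b IHb|a IHa b IHb|||a IHa|a IHa|e p a IHa] /=.
- by move=> _; split=> [V cV|V V' cV cV' le eV]; [exact: cV|exact: le].
- move=> _; split=> [V cV|V V' cV cV' le eV]; first exact: clopen_setC.
  by rewrite (eV p).
- case/andP=> /IHa[ca ma] /IHb[cb mb]; split=> [V cV|V V' cV cV' le eV].
    by apply: clopenI; [exact: ca|exact: cb].
  by apply: setISS; [apply: ma|apply: mb] => // p op; apply: eV; rewrite op ?orbT.
- case/andP=> /IHa[ca ma] /IHb[cb mb]; split=> [V cV|V V' cV cV' le eV].
    by apply: clopenU; [exact: ca|exact: cb].
  by apply: setUSS; [apply: ma|apply: mb] => // p op; apply: eV; rewrite op ?orbT.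
- by move=> _; split=> [V cV|V V' *]; [exact: clopen0|exact: subset_refl].
- by move=> _; split=> [V cV|V V' *]; [exact: clopenT|exact: subset_refl].
- move=> /IHa[ca ma]; split=> [V cV|V V' cV cV' le eV x /= [y [xy sy]]].
    exact/acc_clopen/ca.
  by exists y; split=> //; exact: (ma V V').
- move=> /IHa[ca ma]; split=> [V cV|V V' cV cV' le eV x /= h y xy].
    (* The model axiom speaks of [Dia], so [Box] is rewritten as its De Morgan dual. *)
    have -> : [set x | acc M x `<=` sem a V] =
              ~` [set x | acc M x `&` ~` sem a V !=set0].
      apply/seteqP; split=> x /=; first by move=> h [y [/h]].
      by move=> h y xy; apply: contrapT => ny; apply: h; exists y.
    exact/clopen_setC/acc_clopen/clopen_setC/ca.
  by apply: (ma V V') => //; exact: h.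
- case/andP=> pa /IHa[ca ma].
  have Fc V : clopen_env V -> clopen_endo (fun U => sem a [eta V with p |-> U]).
    by move=> cV U cU; apply: ca; exact: clopen_env_upd.
  have Fm V : clopen_env V -> clopen_mono (fun U => sem a [eta V with p |-> U]).
    move=> cV U W cU cW UW; apply: ma; try exact: clopen_env_upd.
      by move=> q /=; case: eqP => _ //; exact: subset_refl.
    by move=> q oq /=; case: eqP => // qp; move: oq; rewrite qp (negbTE pa).
  split=> [V cV|V V' cV cV' le eV].
    by apply: clopen_fix_clopen; [exact: Fc|exact: Fm].
  apply: clopen_fix_le; [exact: Fc|exact: Fm|exact: Fc|exact: Fm|].
  move=> U cU; apply: ma; try exact: clopen_env_upd.
    by move=> q /=; case: eqP => _; [exact: subset_refl|exact: le].
  by move=> q oq /=; case: eqP => // _; exact: eV.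
Qed.

Lemma sem_clopen (phi : form P) V :
  wf_form phi -> clopen_env V -> clopen (sem phi V).
Proof. by move=> /sem_clopen_mono[+ _]; apply. Qed.

Section Body.
Variables (a : form P) (p : P) (V : P -> set M).
Hypotheses (wfa : wf_form a) (pa : ~~ occurs_negated p a) (cV : clopen_env V).

Lemma sem_body_endo : clopen_endo (fun U => sem a [eta V with p |-> U]).
Proof. by move=> U cU; apply: sem_clopen => //; exact: clopen_env_upd. Qed.

Lemma sem_body_mono : clopen_mono (fun U => sem a [eta V with p |-> U]).
Proof.
move=> U W cU cW UW; have [_] := sem_clopen_mono wfa.
apply; try exact: clopen_env_upd.
  by move=> q /=; case: eqP => _ //; exact: subset_refl.
by move=> q oq /=; case: eqP => // qp; move: oq; rewrite qp (negbTE pa).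
Qed.

End Body.

End ClopenFixpoints.

(** * Dual formulas *)

Section Duality.
Variable P : eqType.
Implicit Types (phi psi chi : form P) (p q : P).

Definition dual_fixop eta := match eta with Mu => Nu | Nu => Mu end.

(* Variables are left alone: the dual formula is evaluated under the
   complemented valuation. *)
Fixpoint dual phi : form P :=
  match phi with
  | Var p => Var p
  | NVar p => NVar p
  | And a b => Or (dual a) (dual b)
  | Or a b => And (dual a) (dual b)
  | Bot => Top
  | Top => Bot
  | Dia a => Box (dual a)
  | Box a => Dia (dual a)
  | Fix eta p a => Fix (dual_fixop eta) p (dual a)
  end.

Lemma dualK : involutive dual.
Proof. by elim=> //= [a -> b ->|a -> b ->|a ->|a ->|[] p a ->]. Qed.

Lemma occurs_negated_dual p phi :
  occurs_negated p (dual phi) = occurs_negated p phi.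
Proof. by elim: phi => //= [a -> b ->|a -> b ->]. Qed.

Lemma wf_form_dual phi : wf_form (dual phi) = wf_form phi.
Proof.
by elim: phi => //= [a -> b ->|a -> b ->|_ p a ->] //; rewrite occurs_negated_dual.
Qed.

Lemma free_vars_dual phi : free_vars (dual phi) = free_vars phi.
Proof. by elim: phi => //= [a -> b ->|a -> b ->|_ p a ->]. Qed.

Lemma bound_vars_dual phi : bound_vars (dual phi) = bound_vars phi.
Proof. by elim: phi => //= [a -> b ->|a -> b ->|_ p a ->]. Qed.

Lemma clean_dual phi : clean (dual phi) = clean phi.
Proof. by rewrite /clean free_vars_dual bound_vars_dual. Qed.

Lemma binder_dual phi p :
  binder (dual phi) p = omap (fun r => (dual_fixop r.1, dual r.2)) (binder phi p).
Proof.
elim: phi => //= [a -> b ->|a -> b ->|e q a ->]; try by case: (binder a p).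
by case: eqP.
Qed.

Lemma subform_dual chi phi : subform chi phi -> subform (dual chi) (dual phi).
Proof.
elim: phi => [p|p|a IHa b IHb|a IHa b IHb|||a IHa|a IHa|e p a IHa] /=;
  (case=> [->|]; first by left); try by [].
all: by try case; auto.
Qed.

Lemma dep_le_dual phi p q : dep_le phi p q -> dep_le (dual phi) p q.
Proof.
rewrite /dep_le !binder_dual.
case: (binder phi p) => [[e a]|] //=; case: (binder phi q) => [[t b]|] //=.
exact: subform_dual (Fix t q b).
Qed.

Definition dual_model (M : edModel P) : edModel P :=
  EdModel (@carrier_stone _ M) (@carrier_ed _ M) (@acc_closed _ M)
    (@acc_clopen _ M) (fun p => clopen_setC (@valuation_clopen _ M p)).

Variable M : edModel P.

(** Restores the complemented form of the valuation below a binder, so that the induction hypothesis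
    of [sem_dual] applies; the inner complement is the one in [conjugate]. *)
Lemma dual_env_upd (V : P -> set M) p U :
  [eta (fun q => ~` V q) with p |-> U] =
  (fun q => ~` [eta V with p |-> ~` U] q) :> (P -> set M).
Proof. by apply: funext => q /=; case: eqP; rewrite ?setCK. Qed.

Lemma clopen_fix_dual eta (F : set M -> set M) :
  clopen_endo F -> clopen_mono F ->
  clopen_fix (dual_fixop eta) (conjugate F) = ~` clopen_fix eta F.
Proof.
case: eta => /= Fc Fm; last by rewrite clopen_nuE ?setCK.
rewrite clopen_nuE ?conjugateK //.
  exact: clopen_endo_conjugate.
exact: clopen_mono_conjugate.
Qed.

Lemma sem_dual phi (V : P -> set M) : wf_form phi -> clopen_env V ->
  sem (dual phi) (fun p => ~` V p) = ~` sem phi V.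
Proof.
elim: phi V => [p|p|a IHa b IHb|a IHa b IHb|||a IHa|a IHa|e p a IHa] V //=.
- by case/andP=> wa wb cV; rewrite setCI IHa ?IHb.
- by case/andP=> wa wb cV; rewrite setCU IHa ?IHb.
- by rewrite setC0.
- by rewrite setCT.
- move=> wa cV; rewrite IHa //; apply/seteqP; split=> x /=.
    by move=> h [y [/h]].
  by move=> h y xy sy; apply: h; exists y.
- move=> wa cV; rewrite IHa //; apply/seteqP; split=> x /=.
    by case=> y [xy ny] /(_ y xy).
  by move=> /existsNP[y /not_implyP[xy ny]]; exists y.
- case/andP=> pa wa cV.
  rewrite -clopen_fix_dual; [|exact: sem_body_endo|exact: sem_body_mono].
  apply: eq_clopen_fix => U cU; rewrite dual_env_upd IHa //.
  by apply: clopen_env_upd => //; exact: clopen_setC.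
Qed.

End Duality.

(** * Scopes of bound variables in clean formulas *)

Section Scoping.
Variable P : eqType.
Implicit Types (phi psi chi a b : form P) (p q : P).

Lemma occurs_negated_subform p chi phi :
  subform chi phi -> occurs_negated p chi -> occurs_negated p phi.
Proof.
elim: phi => [q|q|a IHa b IHb|a IHa b IHb|||a IHa|a IHa|e q a IHa] /=;
  (case=> [->|] //=).
- by case=> [/IHa h /h ->|/IHb h /h ->]; rewrite ?orbT.
- by case=> [/IHa h /h ->|/IHb h /h ->]; rewrite ?orbT.
Qed.

Lemma wf_form_subform chi phi : subform chi phi -> wf_form phi -> wf_form chi.
Proof.
elim: phi => [q|q|a IHa b IHb|a IHa b IHb|||a IHa|a IHa|e q a IHa] /=;
  (case=> [->|] //=).
- by case=> [/IHa h /andP[/h]|/IHb h /andP[_ /h]].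
- by case=> [/IHa h /andP[/h]|/IHb h /andP[_ /h]].
- by move=> /IHa h /andP[_ /h].
Qed.

(** The proviso on fixpoint formulas keeps operators from capturing a negated occurrence. *)
Lemma occurs_negated_free p phi :
  wf_form phi -> occurs_negated p phi -> p \in free_vars phi.
Proof.
elim: phi => [q|q|a IHa b IHb|a IHa b IHb|||a IHa|a IHa|e q a IHa] //=.
- by rewrite inE eq_sym.
- by rewrite mem_cat => /andP[/IHa ha /IHb hb] /orP[/ha|/hb] ->; rewrite ?orbT.
- by rewrite mem_cat => /andP[/IHa ha /IHb hb] /orP[/ha|/hb] ->; rewrite ?orbT.
- case/andP=> qa /IHa h /[dup] pa /h; rewrite mem_filter => ->; rewrite andbT.
  by apply: contraNneq qa => <-.
Qed.

Fixpoint fsize phi : nat :=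
  match phi with
  | And a b | Or a b => (fsize a + fsize b).+1
  | Dia a | Box a | Fix _ _ a => (fsize a).+1
  | Var _ | NVar _ | Bot | Top => 0
  end.

Lemma fsize_subform chi phi : subform chi phi -> fsize chi <= fsize phi.
Proof.
elim: phi => [q|q|a IHa b IHb|a IHa b IHb|||a IHa|a IHa|e q a IHa] /=;
  (case=> [->|] //=).
- case=> [/IHa|/IHb] h; apply/leqW/(leq_trans h); first exact: leq_addr.
  exact: leq_addl.
- case=> [/IHa|/IHb] h; apply/leqW/(leq_trans h); first exact: leq_addr.
  exact: leq_addl.
- by move/IHa/leqW.
- by move/IHa/leqW.
- by move/IHa/leqW.
Qed.

Lemma free_vars_subform chi phi q : subform chi phi -> q \in free_vars chi ->
  q \in free_vars phi \/
  exists e b, subform (Fix e q b) phi /\ subform chi b.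
Proof.
move=> + qchi.
elim: phi => [p|p|a IHa b IHb|a IHa b IHb|||a IHa|a IHa|e p a IHa] /=;
  (case=> [e0|] //=; first by left; move: qchi; rewrite e0).
- rewrite mem_cat; case=> [/IHa|/IHb] [->|[e [c [h h']]]]; rewrite ?orbT; auto;
  right; exists e, c; auto.
- rewrite mem_cat; case=> [/IHa|/IHb] [->|[e [c [h h']]]]; rewrite ?orbT; auto;
  right; exists e, c; auto.
- by case/IHa=> [->|[e [c [h h']]]]; [left|right; exists e, c; auto].
- by case/IHa=> [->|[e [c [h h']]]]; [left|right; exists e, c; auto].
- move=> sa; case: (IHa sa) => [qa|[e' [c [h h']]]]; last first.
    by right; exists e', c; auto.
  case: (eqVneq q p) => [<-|qp]; first by right; exists e, a; auto.
  by left; rewrite mem_filter qp.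
Qed.

Variable phi : form P.
Hypothesis phi_clean : clean phi.

Definition in_body psi p :=
  exists e b, binder phi p = Some (e, b) /\ subform psi b.

Lemma bound_not_free p : p \in bound_vars phi -> p \notin free_vars phi.
Proof. by case/andP: phi_clean => _ /hasPn; apply. Qed.

Lemma free_bound_in_body psi p : subform psi phi -> p \in free_vars psi ->
  p \in bound_vars phi -> in_body psi p.
Proof.
move=> spsi fp bp; have [|[e [b [/(binderP _ _ _ phi_clean) h sb]]]] :=
  free_vars_subform spsi fp; last by exists e, b.
by rewrite (negbTE (bound_not_free bp)).
Qed.

Lemma in_body_trans chi psi p : subform chi psi -> in_body psi p -> in_body chi p.
Proof. by move=> s [e [b [h sb]]]; exists e, b; split=> //; exact: subform_trans sb. Qed.

(** A linear measure refining the dependency order: an operator inside the body of another one has a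
    strictly smaller body. *)
Definition body_size p := if binder phi p is Some (_, b) then fsize b else 0.

Lemma in_body_size psi p : in_body psi p -> fsize psi <= body_size p.
Proof. by case=> e [b [h /fsize_subform]]; rewrite /body_size h. Qed.

Lemma Fix_not_in_own_body e p a : binder phi p = Some (e, a) ->
  ~ in_body (Fix e p a) p.
Proof. by move=> h /in_body_size; rewrite /body_size h /= ltnn. Qed.

End Scoping.

(** * The dominant variable of an infinite play *)

Section InfinitePlays.
Variables (P : eqType) (phi : form P) (M : edModel P).
Hypothesis phi_clean : clean phi.
Implicit Types (z w : eval_pos M) (p q : P) (pi : nat -> eval_pos M).

(* Every step of a play that stays in [under p] is taken inside the scope of
   the operator binding [p]. *)
Definition under p z : Prop :=
  match z with
  | At psi _ => in_body phi psi p
  | Nbh q _ =>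
      q = p \/ exists e b, binder phi q = Some (e, b) /\ in_body phi (Fix e q b) p
  end.

(** Only a visit to a variable [q] can lead out of the scope of [p]. If the operator of [q] were not
    inside the body of [p], it would enclose the operator of [p] and have a larger body, against the
    size assumption. *)
Lemma under_move p z w : legal_pos phi z -> eval_moves phi z w ->
  (forall q, q \in bound_vars phi -> occurs_at q w ->
     body_size phi q <= body_size phi p) ->
  p \in bound_vars phi -> under p z -> under p w.
Proof.
case: z => [[q|q|a b|a b|||a|a|e q a] x|q U] //=.
- case Eq: (binder phi q) => [[e a]|//] sq [U [cU Ux ->]] /= mx bp.
  have bq : q \in bound_vars phi by rewrite -binder_bound Eq.
  case: (eqVneq q p) => [->|qp] ub; [by left|right].
  exists e, a; split=> //; case: ub => e' [b [Ep sb]].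
  have sp : subform (Fix e' p b) phi by apply: binder_subform.
  have sbp : subform b (Fix e' p b) by right; exact: subform_refl.
  have [fq|[t [c [sc _]]]] := free_vars_subform sb (mem_head q [::]).
    have : in_body phi (Fix e' p b) q.
      by apply: free_bound_in_body => //=; rewrite mem_filter qp.
    move/in_body_size=> /= h; have := leq_trans h (mx q bq erefl).
    by rewrite /body_size Ep ltnn.
  exists e', b; split=> //; suff: binder phi q = Some (t, c).
    by rewrite Eq => -[-> ->].
  by apply/binderP => //; apply: subform_trans sp; exact: subform_trans sbp.
- by move=> _ [] -> _ _; apply: in_body_trans; right; [left|right]; exact: subform_refl.
- by move=> _ [] -> _ _; apply: in_body_trans; right; [left|right]; exact: subform_refl.
- by move=> _ [y _ <-] _ _; apply: in_body_trans; right; exact: subform_refl.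
- by move=> _ [y _ <-] _ _; apply: in_body_trans; right; exact: subform_refl.
- by move=> _ -> _ _; apply: in_body_trans; right; exact: subform_refl.
- move=> _; case Eq: (binder phi q) => [[e a]|//] [y _ <-] _ _ /= [<-|].
    by exists e, a; split=> //; exact: subform_refl.
  case=> e' [b [[<- <-]]].
  by apply: in_body_trans; right; exact: subform_refl.
Qed.

Variable pi : nat -> eval_pos M.
Hypotheses (pi_legal : legal_pos phi (pi 0))
  (pi_moves : forall n, eval_moves phi (pi n) (pi n.+1)).

Definition inf_often p := bound_inf_often phi pi p.

Lemma infinite_play_legal n : legal_pos phi (pi n).
Proof. by elim: n => // n IHn; exact: legal_posM IHn (pi_moves n). Qed.

Lemma inf_often_Nbh p : inf_often p -> forall n, exists2 m, n <= m &
  exists U, pi m = Nbh p U.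
Proof.
case=> bp io n; have [m nm] := io n; case Em: (pi m) => [psi x|q U] /=.
  case: psi Em => //= q Em qp; rewrite {}qp in Em.
  exists m.+1; first exact: leqW.
  have := pi_moves m; rewrite Em /=; rewrite -binder_bound in bp.
  by case: binder bp => // _ _ [U [_ _ ->]]; exists U.
by move=> <-; exists m => //; exists U.
Qed.

(** Each of the finitely many bound variables that does not recur has a last visit; [N] is taken
    beyond all of them. *)
Lemma eventually_inf_often : exists N, forall n, N <= n -> forall q,
  q \in bound_vars phi -> occurs_at q (pi n) -> inf_often q.
Proof.
suff h : forall s : seq P, exists N, forall n, N <= n -> forall q,
    q \in s -> q \in bound_vars phi -> occurs_at q (pi n) -> inf_often q.
  have [N HN] := h (bound_vars phi); exists N => n Nn q bq; exact: (HN n Nn q bq bq).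
elim=> [|p s [N HN]]; first by exists 0.
have [ip|nip] := pselect (inf_often p).
  by exists N => n Nn q; rewrite inE => /predU1P[-> //|]; exact: HN.
have [bp|nbp] := boolP (p \in bound_vars phi); last first.
  exists N => n Nn q; rewrite inE => /predU1P[->|]; last exact: HN.
  by rewrite (negbTE nbp).
have [K HK] : exists K, forall n, K <= n -> ~ occurs_at p (pi n).
  apply: contrapT => h; apply: nip; split=> // n.
  by apply: contrapT => h'; apply: h; exists n => m nm om; apply: h'; exists m.
exists (maxn N K) => n; rewrite geq_max => /andP[Nn Kn] q.
rewrite inE => /predU1P[-> _ /HK //|]; exact: HN.
Qed.

Definition pos_size z := if z is At psi _ then fsize psi else 0.

(** Between visits to bound variables the formula shrinks, so a play that stops visiting them cannot
    be infinite. *)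
Lemma move_size_lt z w : eval_moves phi z w ->
  (forall q, q \in bound_vars phi -> ~ occurs_at q z) ->
  pos_size w < pos_size z.
Proof.
case: z => [[q|q|a b|a b|||a|a|e q a] x|q U] //=.
- case Eq: binder => [r|//] _ /(_ q); rewrite -binder_bound Eq.
  by move=> /(_ isT) [].
- by case=> -> _ /=; rewrite ltnS ?leq_addr ?leq_addl.
- by case=> -> _ /=; rewrite ltnS ?leq_addr ?leq_addl.
- by case=> y _ <-.
- by case=> y _ <-.
- by move=> ->.
- case Eq: binder => [r|//] _ /(_ q); rewrite -binder_bound Eq.
  by move=> /(_ isT) [].
Qed.

Lemma exists_inf_often : exists p, inf_often p.
Proof.
apply: contrapT => nio; have [N HN] := eventually_inf_often.
have dec k : pos_size (pi (N + k)) + k <= pos_size (pi N).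
  elim: k => [|k IHk]; first by rewrite !addn0.
  apply: leq_trans IHk; rewrite !addnS -addSn leq_add2r.
  apply: move_size_lt => // q bq /(HN _ (leq_addr _ _) q bq) iq.
  by apply: nio; exists q.
have := dec (pos_size (pi N)).+1.
by rewrite addnS ltnNge leq_addl.
Qed.

Lemma exists_inf_often_max :
  exists2 p, inf_often p & forall q, inf_often q -> body_size phi q <= body_size phi p.
Proof.
pose A k := `[< exists2 p, inf_often p & body_size phi p = k >].
have exA : exists k, A k.
  by have [p ip] := exists_inf_often; exists (body_size phi p); apply/asboolP; exists p.
have ubA k : A k -> k <= fsize phi.
  case/asboolP=> p _ <-; rewrite /body_size.
  case E: binder => [[e b]|//]; apply: ltnW.
  exact: fsize_subform (binder_subform E).
case: (ex_maxnP exA ubA) => k /asboolP[p ip <-] mx.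
by exists p => // q iq; apply: mx; apply/asboolP; exists q.
Qed.

(** The candidate is a recurring variable with the largest body. From a visit to it after all
    non-recurring variables have died out, the play stays in its scope, so every recurring variable
    is seen there. *)
Lemma exists_dominant : exists p, [/\ inf_often p,
  forall q, inf_often q -> dep_le phi q p &
  exists N, forall n, N <= n -> under p (pi n)].
Proof.
have [p ip mx] := exists_inf_often_max; have [N HN] := eventually_inf_often.
have [N' NN' [U EU]] := inf_often_Nbh ip N.
have up n : N' <= n -> under p (pi n).
  elim: n => [|n IHn]; first by rewrite leqn0 => /eqP <-; rewrite EU; left.
  rewrite leq_eqVlt => /predU1P[<-|]; first by rewrite EU; left.
  move=> Nn; apply: under_move (infinite_play_legal n) (pi_moves n) _ _ (IHn Nn).
    move=> q bq oq; apply: mx; apply: HN oq => //.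
    exact: leq_trans NN' (leqW Nn).
  by case: ip.
exists p; split=> //; last by exists N'.
move=> q iq; have [n Nn [W EW]] := inf_often_Nbh iq N'.
have := up _ Nn; rewrite EW /= /dep_le => -[->|].
  case: ip; rewrite -binder_bound; case: binder => // -[e a] _ _.
  exact: subform_refl.
by case=> e [b [-> [e' [c [-> sc]]]]]; right.
Qed.

Lemma dep_le_anti p q : dep_le phi p q -> dep_le phi q p -> p = q.
Proof.
rewrite /dep_le; case: (binder phi p) => [[e a]|//]; case: (binder phi q) => [[t b]|//].
case=> [[_ -> _] //|sp sq].
by have := leq_trans (fsize_subform sq) (fsize_subform sp); rewrite ltnn.
Qed.

(** The winning condition names a maximal recurring variable; [p] lies above all recurring ones, so
    antisymmetry leaves no other candidate. *)
Lemma eval_wins_dominant p : inf_often p ->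
  (forall q, inf_often q -> dep_le phi q p) ->
  eval_wins phi pi <-> exists a, binder phi p = Some (Nu, a).
Proof.
move=> ip dom; split=> [[q [iq mq nq]]|np].
  by rewrite (mq p ip (dom q iq)).
exists p; split=> // q iq pq; exact: dep_le_anti (dom _ iq) pq.
Qed.

End InfinitePlays.

(** * Strategies with memory *)

Section Certificates.
Variables (G : game) (z : pos G).

(* A positional strategy for [pl] in a product of the game with a space [S] of
   memory states; [step] singles out the transitions that it allows. *)
Definition certified (pl : player) (win : set (nat -> pos G)) :=
  exists (S : Type) (at_ : S -> pos G) (step : S -> S -> Prop) (s0 : S),
  [/\ at_ s0 = z,
      forall s, owner (at_ s) = pl ->
        exists2 s', moves (at_ s) (at_ s') & step s s',
      forall s w, owner (at_ s) <> pl -> moves (at_ s) w ->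
        exists2 s', at_ s' = w & step s s' &
      forall r : nat -> S, r 0 = s0 ->
        (forall n, moves (at_ (r n)) (at_ (r n.+1))) ->
        (forall n, step (r n) (r n.+1)) -> win (at_ \o r)].

(** The memory state is recomputed from the history, choice selecting a permitted successor at each
    step. *)
Lemma certified_winning_strategy :
  certified Eloise (@eloise_wins G) -> eloise_has_winning_strategy z.
Proof.
case=> S [at_ [step [s0 [at0 own opp win]]]].
have [|nxt nxtP] := @choice (S * pos G) S (fun sw t =>
    (exists2 s', at_ s' = sw.2 & step sw.1 s') -> at_ t = sw.2 /\ step sw.1 t).
  move=> [s w] /=.
  have [[s' e st]|h] := pselect (exists2 s', at_ s' = w & step s s').
    by exists s'.
  by exists s.
have [|elo eloP] := @choice (S * pos G) (pos G) (fun sv w =>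
    (~ stuck sv.2 -> moves sv.2 w) /\
    (at_ sv.1 = sv.2 -> owner sv.2 = Eloise ->
       exists2 s', at_ s' = w & step sv.1 s')).
  move=> [s v] /=.
  have [[e o]|h] := pselect (at_ s = v /\ owner v = Eloise).
    rewrite -e in o *; have [s' m st] := own _ o.
    by exists (at_ s'); split=> // _ _; exists s'.
  (* Off the certified plays any legal move will do: [eloise_strategy] demands legality on all
     plays, also on those that the strategy does not guide. *)
  have [sv|nsv] := pselect (stuck v).
    by exists v; split=> // e o; case: h.
  have [w vw] : exists w, moves v w.
    apply: contrapT => nw; apply: nsv; apply/seteqP; split=> // w vw.
    by apply: nw; exists w.
  by exists w; split=> // e o; case: h.
(* [behead] drops the initial position, which [s0] already represents. *)
pose run h := foldl (fun s w => nxt (s, w)) s0 (behead h).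
pose sigma h := elo (run h, last z h).
have lastE pi n : last z (mkseq pi n.+1) = pi n by rewrite mkseqS last_rcons.
have runS pi n : run (mkseq pi n.+2) = nxt (run (mkseq pi n.+1), pi n.+1).
  rewrite /run mkseqS; have -> : behead (rcons (mkseq pi n.+1) (pi n.+1)) =
    rcons (behead (mkseq pi n.+1)) (pi n.+1) by [].
  by rewrite -cats1 foldl_cat.
have follow pi n : guided z sigma pi n ->
    at_ (run (mkseq pi n.+1)) = pi n /\
    forall i, i < n -> step (run (mkseq pi i.+1)) (run (mkseq pi i.+2)).
  elim: n => [|n IHn] [[pi0 mv] gd]; first by split=> //; rewrite pi0.
  have [|atn stn] := IHn.
    by split=> [|i ilt]; [split=> // i ilt; apply/mv/leqW|apply/gd/leqW].
  have [] : at_ (run (mkseq pi n.+2)) = pi n.+1 /\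
            step (run (mkseq pi n.+1)) (run (mkseq pi n.+2)).
    rewrite runS; apply: nxtP => /=.
    case o: (owner (pi n)).
      rewrite (gd n (ltnSn _) o) /sigma lastE.
      by have [_] := eloP (run (mkseq pi n.+1), pi n); apply.
    by apply: opp; rewrite atn ?o //; exact: mv.
  move=> atn1 stn1; split=> // i; rewrite ltnS leq_eqVlt => /predU1P[-> //|].
  exact: stn.
exists sigma; split.
- move=> pi n _ o ns; rewrite /sigma lastE.
  by have [+ _] := eloP (run (mkseq pi n.+1), pi n); apply.
- move=> pi n /follow[atn _] st; case o: (owner (pi n)) => //.
  rewrite -atn in o st; have [s' m _] := own _ o.
  by have : set0 (at_ s') by rewrite -st.
- move=> pi gd; have atn n : at_ (run (mkseq pi n.+1)) = pi n.
    by have [] := follow _ _ (gd n).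
  have -> : pi = at_ \o (fun n => run (mkseq pi n.+1)).
    by apply: funext => n /=; rewrite atn.
  apply: win => // n.
    by rewrite !atn; have [[_ mv] _] := gd n.+1; exact: mv.
  by have [_ st] := follow _ _ (gd n.+1); exact: st.
Qed.

(** The two strategies are run against each other: [sigma] reads the history, the certificate reads
    the memory state, and neither player gets stuck. *)
Lemma certified_abelard_play (win : set (nat -> pos G)) :
  certified Abelard win -> eloise_has_winning_strategy z ->
  exists pi, [/\ pi 0 = z, forall n, moves (pi n) (pi n.+1),
                 eloise_wins pi & win pi].
Proof.
case=> S [at_ [step [s0 [at0 own opp win_r]]]] [sigma [legal nstuck winsigma]].
pose good (hs : seq (pos G) * S) s' :=
  [/\ step hs.2 s', moves (at_ hs.2) (at_ s') &
      owner (at_ hs.2) = Eloise -> at_ s' = sigma hs.1].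
have [|nxt nxtP] := @choice (seq (pos G) * S) S
    (fun hs t => (exists s', good hs s') -> good hs t).
  move=> hs; have [[s' g]|h] := pselect (exists s', good hs s').
    by exists s'.
  by exists s0.
pose X := fix X n := if n is n'.+1
  then (rcons (X n').1 (at_ (nxt (X n'))), nxt (X n')) else ([:: z], s0).
pose pi n := at_ (X n).2.
have XE n : (X n).1 = mkseq pi n.+1.
  elim: n => [|n IHn]; first by rewrite /= /mkseq /= /pi /= at0.
  by rewrite mkseqS -IHn.
have guidedS n : guided z sigma pi n -> good (X n) (X n.+1).2 ->
    guided z sigma pi n.+1.
  case=> -[p0 mv] gd [_ m e]; split; first split=> // i.
    by rewrite ltnS leq_eqVlt => /predU1P[->//|]; exact: mv.
  move=> i; rewrite ltnS leq_eqVlt => /predU1P[->|]; last exact: gd.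
  by rewrite -XE; exact: e.
have goodX n : guided z sigma pi n -> good (X n) (X n.+1).2.
  move=> gd; apply: nxtP; case o: (owner (pi n)).
    have ns : ~ stuck (pi n) by move=> st; have := nstuck _ _ gd st; rewrite o.
    have m := legal _ _ gd.1 o ns.
    have [|s' e st] := opp (X n).2 _ _ m; first by rewrite -/(pi n) o.
    by exists s'; split; rewrite ?e ?XE.
  have [s' m st] := own _ o; exists s'; split=> //.
  by rewrite -/(pi n) o.
have gd n : guided z sigma pi n.
  elim: n => [|n IHn]; first by split=> //; split.
  exact: guidedS (goodX _ IHn).
have gX n := goodX _ (gd n).
exists pi; split=> //; first by move=> n; case: (gX n).
  exact: winsigma.
by apply: (win_r (fun n => (X n).2)) => // n; case: (gX n).
Qed.

End Certificates.

(** * Transfinite approximants of least fixpoints *)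

Section Approximants.
Variables (P : eqType) (M : edModel P).
Implicit Types (F : set M -> set M) (U : set M).

(* Notations for ordinals, branching over all sets of points. *)
Inductive stage := Zero | Limit of (set M -> stage).

Fixpoint approx F (s : stage) : set M :=
  if s is Limit f then closure (\bigcup_U F (approx F (f U))) else set0.

Lemma approx_clopen F s : clopen_endo F -> clopen (approx F s).
Proof.
move=> Fc; elim: s => [|f IHf] /=; first exact: clopen0.
by apply/clopen_closure_open/bigcup_open => U _; case: (Fc _ (IHf U)).
Qed.

(* The stage enumerating one notation of each approximant yields a clopen
   prefixpoint. *)
Lemma mu_sub_approx F : clopen_endo F -> clopen_mono F ->
  exists s, clopen_fix Mu F `<=` approx F s.
Proof.
move=> Fc Fm; have [|f fP] := @choice (set M) stage (fun U s =>
    (exists t, approx F t = U) -> approx F s = U).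
  move=> U; have [[t tU]|nt] := pselect (exists t, approx F t = U).
    by exists t.
  by exists Zero.
exists (Limit f); have [_ _] := clopen_muP Fc Fm; apply.
  exact: approx_clopen.
pose V := approx F (Limit f).
(* [V] is itself an approximant, so [f] enumerates a notation for it; hence [F V] is one of the sets
   whose union has closure [V]. *)
have fV : approx F (f V) = V by apply: fP; exists (Limit f).
move=> y; rewrite -/V -{1}fV => Fy.
by apply: subset_closure; exists V.
Qed.

End Approximants.

(** * Truth yields a strategy for Eloise *)

Section TruthToStrategy.
Variables (P : eqType) (phi : form P) (M : edModel P).
Hypotheses (phi_wf : wf_form phi) (phi_clean : clean phi).
Implicit Types (psi chi a b : form P) (p q : P) (x y : M) (U : set M).

(* [fstage] is only meaningful when [fvar] is bound by mu. *)
Record frame := Frame { fvar : P; fval : set M; fstage : stage M }.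
Implicit Types (fr : frame) (Gam : seq frame).

Definition dom Gam := map fvar Gam.

Fixpoint env Gam : P -> set M :=
  if Gam is fr :: Gam' then [eta env Gam' with fvar fr |-> fval fr]
  else valuation M.

(** The stack acts as a lexical environment: it interprets the free variables of [psi] that [phi]
    binds, and holds only variables whose body contains [psi]. *)
Definition scoped psi Gam :=
  [/\ subform psi phi,
      {in free_vars psi, forall q, q \in bound_vars phi -> q \in dom Gam} &
      {in dom Gam, forall q, in_body phi psi q}].

Notation body_map a p V := (fun U => sem a [eta V with p |-> U]).

(** A value is tied to the body evaluated in the stack below its frame: a mu-value is an
    approximant, which can be lowered, and a nu-value is a postfixpoint, which can be kept
    forever. *)
Definition frame_ok fr Gam := exists e a,
  [/\ binder phi (fvar fr) = Some (e, a), scoped (Fix e (fvar fr) a) Gam,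
      clopen (fval fr) &
      match e with
      | Mu => fval fr = approx (body_map a (fvar fr) (env Gam)) (fstage fr)
      | Nu => fval fr `<=` body_map a (fvar fr) (env Gam) (fval fr)
      end].

Fixpoint coherent Gam :=
  if Gam is fr :: Gam' then frame_ok fr Gam' /\ coherent Gam' else True.

Lemma coherent_cat Gam1 Gam2 : coherent (Gam1 ++ Gam2) -> coherent Gam2.
Proof. by elim: Gam1 => //= fr Gam1 IH [_ /IH]. Qed.

Lemma coherent_clopen Gam : coherent Gam -> clopen_env (env Gam).
Proof.
elim: Gam => [_|fr Gam IH /= [[e [a [_ _ cU _]]] /IH cG]] /=.
  exact: valuation_clopen.
exact: clopen_env_upd.
Qed.

Lemma coherent_bound Gam : coherent Gam -> {subset dom Gam <= bound_vars phi}.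
Proof.
elim: Gam => [//|fr Gam IH /= [[e [a [h _ _ _]]] /IH sG]] q.
by rewrite inE => /predU1P[->|/sG //]; rewrite -binder_bound h.
Qed.

Lemma coherent_nested Gam1 fr Gam2 p : coherent (Gam1 ++ fr :: Gam2) ->
  p \in dom Gam1 -> exists e a,
  binder phi p = Some (e, a) /\ in_body phi (Fix e p a) (fvar fr).
Proof.
elim: Gam1 => //= fr1 Gam1 IH [[e [a [h [_ _ nest] _ _]]] /IH {}IH].
rewrite inE => /predU1P[->|//]; exists e, a; split=> //; apply: nest.
by rewrite /dom map_cat mem_cat /= mem_head orbT.
Qed.

Lemma env_free Gam p : coherent Gam -> p \notin bound_vars phi ->
  env Gam p = valuation M p.
Proof.
move=> /coherent_bound; elim: Gam => //= fr Gam IH sG np.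
case: eqP => [pfr|_]; last by apply: IH => // q qG; apply: sG; rewrite inE qG orbT.
by case/negP: np; apply: sG; rewrite inE pfr eqxx.
Qed.

Lemma split_stack Gam p : p \in dom Gam -> exists Gam1 fr Gam0,
  [/\ Gam = Gam1 ++ fr :: Gam0, p \notin dom Gam1, fvar fr = p &
      env Gam p = fval fr].
Proof.
elim: Gam => //= fr Gam IH; rewrite inE eq_sym.
case: (eqVneq (fvar fr) p) => [frp _|nfrp /= /IH[Gam1 [fr1 [Gam0 [-> np frp1 e]]]]].
  by exists [::], fr, Gam.
by exists (fr :: Gam1), fr1, Gam0; split=> //=; rewrite inE negb_or eq_sym nfrp.
Qed.

Lemma scoped_sub psi chi Gam : scoped psi Gam -> subform chi psi ->
  {subset free_vars chi <= free_vars psi} -> scoped chi Gam.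
Proof.
case=> spsi fpsi bpsi schi fchi; split; first exact: subform_trans spsi.
  by move=> q /fchi; exact: fpsi.
by move=> q /bpsi; exact: in_body_trans.
Qed.

Lemma scoped_body fr Gam e a : binder phi (fvar fr) = Some (e, a) ->
  scoped (Fix e (fvar fr) a) Gam -> scoped a (fr :: Gam).
Proof.
have sa : subform a (Fix e (fvar fr) a) by right; exact: subform_refl.
move=> h [s f n]; split; first exact: subform_trans s.
  move=> q qa bq; rewrite inE; case: eqVneq => //= qfr; apply: f => //=.
  by rewrite mem_filter qfr.
move=> q; rewrite inE => /predU1P[->|qG].
  by exists e, a; split=> //; exact: subform_refl.
exact: in_body_trans sa (n _ qG).
Qed.

Lemma binder_wf p e a : binder phi p = Some (e, a) ->
  wf_form a /\ ~~ occurs_negated p a.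
Proof. by move=> /binder_subform/wf_form_subform/(_ phi_wf)/andP[]. Qed.

Lemma body_map_endo Gam p e a : coherent Gam -> binder phi p = Some (e, a) ->
  clopen_endo (body_map a p (env Gam)).
Proof. by move=> /coherent_clopen cG /binder_wf[wa pa]; exact: sem_body_endo. Qed.

Lemma body_map_mono Gam p e a : coherent Gam -> binder phi p = Some (e, a) ->
  clopen_mono (body_map a p (env Gam)).
Proof. by move=> /coherent_clopen cG /binder_wf[wa pa]; exact: sem_body_mono. Qed.

Definition state := (eval_pos M * seq frame)%type.

(** The condition at [Nbh p U] depends on who chose [U]: Abelard's choice for mu need only meet the
    stored value, while Eloise's choice for nu must lie inside it, since Abelard picks the point. *)
Definition truthful (s : state) : Prop :=
  coherent s.2 /\
  match s.1 with
  | At psi x => scoped psi s.2 /\ sem psi (env s.2) x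
  | Nbh p U =>
      if s.2 is fr :: _ then
        [/\ fvar fr = p, clopen U &
            exists e a, binder phi p = Some (e, a) /\
              match e with Mu => U `&` fval fr !=set0 | Nu => U `<=` fval fr end]
      else False
  end.

(** The stack follows the scopes: a fixpoint formula pushes a frame, a variable pops back to its own
    frame, and unfolding a mu-variable moves that frame to an immediate predecessor of its stage. *)
Definition transition (s t : state) : Prop :=
  match s.1 with
  | At (Fix e p a) _ => exists U g, t.2 = Frame p U g :: s.2
  | At (Var p) _ => exists Gam1 fr Gam0,
      [/\ s.2 = Gam1 ++ fr :: Gam0, p \notin dom Gam1, fvar fr = p &
          t.2 = fr :: Gam0]
  | Nbh p _ => exists fr fr' Gam0,
      [/\ s.2 = fr :: Gam0, t.2 = fr' :: Gam0, fvar fr = p, fvar fr' = p &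
          forall a, binder phi p = Some (Mu, a) ->
            exists f U, fstage fr = Limit f /\ fstage fr' = f U]
  | At _ _ => t.2 = s.2
  end.

Lemma push_frame e p a x Gam : truthful (At (Fix e p a) x, Gam) ->
  exists t, [/\ t.1 = At a x, truthful t & transition (At (Fix e p a) x, Gam) t].
Proof.
case=> /= cG [sc sx]; have [sFix _ _] := sc.
have h : binder phi p = Some (e, a) by apply/binderP.
have Fc := body_map_endo cG h; have Fm := body_map_mono cG h.
have [U [g [cU xU ok]]] : exists U g, [/\ clopen U, body_map a p (env Gam) U x &
    match e with
    | Mu => U = approx (body_map a p (env Gam)) g
    | Nu => U `<=` body_map a p (env Gam) U
    end].
  (* A nu-frame stores the greatest fixpoint with a dummy stage. A mu-frame stores an approximant
     above the least fixpoint, and monotonicity carries the body's truth at [x] over to it. *)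
  case: e {sc sFix h} sx => sx; last first.
    have [cU eU _] := clopen_nuP Fc Fm.
    exists (clopen_fix Nu (body_map a p (env Gam))), (Zero M).
    by split=> //; rewrite eU.
  have [g leg] := mu_sub_approx Fc Fm; have [cU eU _] := clopen_muP Fc Fm.
  exists (approx (body_map a p (env Gam)) g), g; split=> //.
    exact: approx_clopen.
  apply: (Fm _ _ cU (approx_clopen g Fc) leg x).
  by rewrite eU.
exists (At a x, Frame p U g :: Gam); split=> //; last by exists U, g.
split; first by split=> //; exists e, a.
by split=> //; exact: (@scoped_body (Frame p U g) _ _ _ h sc).
Qed.

Lemma unfold_nu p a U y Gam : truthful (Nbh p U, Gam) ->
  binder phi p = Some (Nu, a) -> U y ->
  truthful (At a y, Gam) /\ transition (Nbh p U, Gam) (At a y, Gam).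
Proof.
case: Gam => [|fr Gam] [] //= [[e [a' [h sc cW ok]]] cG] [frp cU].
case=> e1 [a1 [h1 inU]] hp Uy; subst p.
move: h h1; rewrite hp => -[? ?] [? ?]; subst e a' e1 a1.
split; last first.
  exists fr, fr, Gam; split=> // b; by rewrite hp.
split; first by split=> //; exists Nu, a.
split; first exact: scoped_body hp sc.
exact/ok/inU.
Qed.

Lemma unfold_mu p a U Gam : truthful (Nbh p U, Gam) ->
  binder phi p = Some (Mu, a) ->
  exists2 t, (exists2 y, U y & t.1 = At a y) &
    truthful t /\ transition (Nbh p U, Gam) t.
Proof.
case: Gam => [|fr Gam] [] //= [[e [a' [h sc cW ok]]] cG] [frp cU].
case=> e1 [a1 [h1 inU]] hp; subst p.
move: h h1; rewrite hp => -[? ?] [? ?]; subst e a' e1 a1.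
(* The value at [Zero] is empty, so the stage is a limit and [x] lies in a closure; the open set [U]
   around [x] then meets the body evaluated at an earlier approximant. *)
case: inU => x [Ux]; rewrite ok; case Efr: (fstage fr) => [//|f] /= xf.
have [oU _] := cU; have [y [[W _ Fy] Uy]] := xf _ (open_nbhs_nbhs (conj oU Ux)).
pose fr' := Frame (fvar fr) (approx (body_map a (fvar fr) (env Gam)) (f W)) (f W).
exists (At a y, fr' :: Gam); first by exists y.
split; last first.
  by exists fr, fr', Gam; split=> // b _; exists f, W.
split.
  split=> //; exists Mu, a; split=> //; apply: approx_clopen.
  exact: body_map_endo cG hp.
by split=> //; exact: (@scoped_body fr' _ _ _ hp sc).
Qed.

(** Popping does not depend on [U], so one stack answers every choice of Abelard at a mu-variable;
    at a nu-variable Eloise plays the stored value. *)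
Lemma enter_var p e a x Gam : truthful (At (Var p) x, Gam) ->
  binder phi p = Some (e, a) -> exists2 Gam',
    (forall U, clopen U -> U x -> transition (At (Var p) x, Gam) (Nbh p U, Gam') /\
      (e = Mu -> truthful (Nbh p U, Gam'))) &
    e = Nu -> exists U, [/\ clopen U, U x & truthful (Nbh p U, Gam')].
Proof.
case=> /= cG [[_ fv _] sx] h.
have pG : p \in dom Gam by apply: fv; rewrite ?mem_head // -binder_bound h.
have [Gam1 [fr [Gam0 [EG np frp ep]]]] := split_stack pG.
have cG0 : coherent (fr :: Gam0) by move: cG; rewrite EG; exact: coherent_cat.
rewrite ep in sx; exists (fr :: Gam0).
  move=> U cU Ux; split; first by exists Gam1, fr, Gam0.
  move=> eMu; split=> //=; split=> //; exists e, a; split=> //.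
  by rewrite eMu; exists x.
move=> eNu; have [[e' [a' [_ _ cW _]]] _] := cG0.
exists (fval fr); split=> //; split=> //; split=> //; exists e, a; split=> //.
by rewrite eNu; exact: subset_refl.
Qed.

(** A negated variable is free in [phi] by well-formedness, hence unbound by cleanliness, and the
    stack leaves its value alone. *)
Lemma literal_unbound p x Gam : truthful (At (NVar p) x, Gam) ->
  ~ valuation M p x.
Proof.
case=> /= cG [[s _ _]]; rewrite env_free //; apply/negP => bp.
have /negP[] := bound_not_free phi_clean bp; apply: occurs_negated_free => //.
exact: occurs_negated_subform s (eqxx p).
Qed.

Lemma truthful_eloise s : truthful s -> eval_owner phi s.1 = Eloise ->
  exists t, [/\ eval_moves phi s.1 t.1, truthful t & transition s t].
Proof.
case: s => -[[p|p|a b|a b|||a|a|e p a] x|p U] Gam T.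
- rewrite /=; case h: (binder phi p) => [[[] a]|] //.
    move=> _; have [Gam' tr /(_ erefl)[U [cU Ux tU]]] := enter_var T h.
    by exists (Nbh p U, Gam'); split=> //; [exists U|case: (tr U cU Ux)].
  case: ifPn => // /negP; rewrite in_setE; case: T => /= cG [_ sx].
  by rewrite -(env_free cG) // -binder_bound h.
- by rewrite /=; case: ifPn => //; rewrite in_setE => /(literal_unbound T).
- by [].
- case: T => /= cG [sc [sx|sx]] _.
    exists (At a x, Gam); split=> //=; [by left|split=> //; split=> //].
    apply: scoped_sub sc _ _; first by right; left; exact: subform_refl.
    by move=> q; rewrite /= mem_cat => ->.
  exists (At b x, Gam); split=> //=; [by right|split=> //; split=> //].
  apply: scoped_sub sc _ _; first by right; right; exact: subform_refl.
  by move=> q; rewrite /= mem_cat => ->; rewrite orbT.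
- by case: T => _ [].
- by [].
- case: T => /= cG [sc [y [xy sy]]] _.
  exists (At a y, Gam); split=> //=; [by exists y|split=> //; split=> //].
  by apply: scoped_sub sc _ _ => //; right; exact: subform_refl.
- by [].
- by have [t [e1 T' tr]] := push_frame T; exists t; rewrite e1.
- rewrite /=; case h: (binder phi p) => [[[] a]|] // _; last first.
    by case: T; case: Gam => [|fr Gam] _ //= [_ _ [e [a [h' _]]]]; rewrite h in h'.
  have [t [y Uy ty] [T' tr]] := unfold_mu T h.
  by exists t; split=> //; rewrite ty; exists y.
Qed.

Lemma truthful_abelard s w : truthful s -> eval_owner phi s.1 = Abelard ->
  eval_moves phi s.1 w -> exists2 t, t.1 = w & truthful t /\ transition s t.
Proof.
case: s => -[[p|p|a b|a b|||a|a|e p a] x|p U] Gam T //=.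
- case h: (binder phi p) => [[[] a]|] // _ [U [cU Ux ->]].
  have [Gam' tr _] := enter_var T h; have [tU /(_ erefl) TU] := tr U cU Ux.
  by exists (Nbh p U, Gam').
- case: T => /= cG [sc [sa sb]] _ [] ->.
    exists (At a x, Gam) => //; do 3![split=> //].
    apply: scoped_sub sc _ _; first by right; left; exact: subform_refl.
    by move=> q; rewrite /= mem_cat => ->.
  exists (At b x, Gam) => //; do 3![split=> //].
  apply: scoped_sub sc _ _; first by right; right; exact: subform_refl.
  by move=> q; rewrite /= mem_cat => ->; rewrite orbT.
- case: T => /= cG [sc sx] _ [y xy <-].
  exists (At a y, Gam) => //; split=> //; split=> //; split; last exact: sx.
  by apply: scoped_sub sc _ _ => //; right; exact: subform_refl.
- case h: (binder phi p) => [[[] a]|] // _ [y Uy <-].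
  by have := unfold_nu T h Uy; exists (At a y, Gam).
Qed.

Fixpoint top_stage p Gam : option (stage M) :=
  if Gam is fr :: Gam' then
    if fvar fr == p then Some (fstage fr) else top_stage p Gam'
  else None.

Lemma top_stage_cat p Gam1 Gam2 : p \notin dom Gam1 ->
  top_stage p (Gam1 ++ Gam2) = top_stage p Gam2.
Proof.
by elim: Gam1 => //= fr Gam1 IH; rewrite inE negb_or eq_sym => /andP[/negbTE-> /IH].
Qed.

(** Two moves could disturb the frame of [p]. Popping past it to [q] would put the operators of [p]
    and [q] each inside the body of the other; pushing a second one would put the operator of [p]
    inside its own body. *)
Lemma top_stage_transition p s t : truthful s -> transition s t ->
  eval_moves phi s.1 t.1 -> under phi p s.1 -> under phi p t.1 ->
  ~ (exists U, s.1 = Nbh p U) -> top_stage p t.2 = top_stage p s.2.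
Proof.
case: s => -[[q|q|a b|a b|||a|a|e q a] x|q U] Gam T; rewrite /transition /=;
  try by move=> ->.
- case=> Gam1 [fr [Gam0 [EG nq frq ->]]]; case: binder => // _ [U [_ _ ->]] _ ut _.
  case: T => cG _; rewrite /= EG in cG *.
  case: (eqVneq q p) => [qp|qp]; first by rewrite top_stage_cat // -qp.
  rewrite top_stage_cat //; apply/negP => /(coherent_nested cG)[e [a [h]]].
  rewrite frq => /in_body_size /= sz1; case: ut => [/eqP|]; first by rewrite (negbTE qp).
  case=> e' [b [h' /in_body_size /= sz2]]; move: sz1 sz2.
  rewrite /body_size h h' => sz1 sz2.
  by have := leq_trans sz1 (ltnW sz2); rewrite ltnn.
- case=> U [g ->] _ up _ _ /=; case: eqP => // qp; rewrite -qp in up.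
  case: T => _ [[s _ _] _]; have h : binder phi q = Some (e, a) by apply/binderP.
  by case: (Fix_not_in_own_body h).
- case=> fr [fr' [Gam0 [-> -> frq frq' _]]] _ _ _ nq /=.
  by rewrite frq frq'; case: eqP => // qp; case: nq; exists U; rewrite qp.
Qed.

(** If the dominant variable were bound by mu, its stage would drop at each of infinitely many
    unfoldings and stay put in between. *)
Lemma truthful_play_wins (r : nat -> state) :
  legal_pos phi (r 0).1 -> (forall n, truthful (r n)) ->
  (forall n, eval_moves phi (r n).1 (r n.+1).1) ->
  (forall n, transition (r n) (r n.+1)) -> eval_wins phi (fun n => (r n).1).
Proof.
move=> leg T mv tr; have [p [ip dom [N up]]] := exists_dominant phi_clean leg mv.
apply/(eval_wins_dominant ip dom).
case: (ip) => + _; rewrite -binder_bound.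
case h: (binder phi p) => [[[] a]|] // _; last by exists a.
have nbh_stage n U : (r n).1 = Nbh p U -> exists g, top_stage p (r n).2 = Some g.
  case: (T n) => _ + e; rewrite e; case: (r n).2 => // fr Gam [<- _ _] /=.
  by rewrite eqxx; exists (fstage fr).
have unfolded n g : top_stage p (r n).2 = Some g ->
    (exists U, (r n).1 = Nbh p U) ->
    exists f W, g = Limit f /\ top_stage p (r n.+1).2 = Some (f W).
  move=> tn [U nU]; have := tr n; rewrite /transition nU.
  case=> fr [fr' [Gam0 [e -> frp frp' /(_ _ h)[f [W [ef ef']]]]]].
  move: tn; rewrite e /= frp frp' eqxx ef ef' => -[<-].
  by exists f, W.
have kept n : N <= n -> ~ (exists U, (r n).1 = Nbh p U) ->
    top_stage p (r n.+1).2 = top_stage p (r n).2.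
  by move=> Nn; apply: top_stage_transition => //; apply: up; rewrite ?leqW.
(* [k] is the distance to some later unfolding of [p]; the stage drops at the first unfolding on the
   way. *)
have descend k n g : N <= n -> top_stage p (r n).2 = Some g ->
    (exists U, (r (n + k)).1 = Nbh p U) ->
    exists m f W, [/\ N <= m, g = Limit f & top_stage p (r m).2 = Some (f W)].
  elim: k n => [|k IHk] n Nn tn.
    by rewrite addn0 => /(unfolded _ _ tn)[f [W [-> t]]]; exists n.+1, f, W; rewrite leqW.
  rewrite addnS -addSn; have [/(unfolded _ _ tn)[f [W [-> t]]] _|nU] :=
    pselect (exists U, (r n).1 = Nbh p U).
    by exists n.+1, f, W; rewrite leqW.
  by apply: IHk; rewrite ?leqW // kept.
have no g n : N <= n -> top_stage p (r n).2 = Some g -> False.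
  elim: g n => [|f IHf] n Nn tn; have [m nm mU] := inf_often_Nbh mv ip n;
    rewrite -(subnKC nm) in mU;
    have [m' [f' [W [Nm' // e tm']]]] := descend _ _ _ Nn tn mU.
  by move: tm'; case: e => <-; exact: IHf.
have [n Nn [U nU]] := inf_often_Nbh mv ip N.
have [g ng] := nbh_stage _ _ nU; by case: (no g n Nn ng).
Qed.

Lemma sem_certified x : sem phi (valuation M) x ->
  @certified (eval_game phi M) (At phi x) Eloise (@eval_wins _ phi M).
Proof.
move=> sx.
have T0 : truthful (At phi x, [::]).
  split=> //; split=> //; split=> //; first exact: subform_refl.
  by move=> q fq /(bound_not_free phi_clean); rewrite fq.
exists {s : state | truthful s}, (fun s => (sval s).1),
  (fun s t => transition (sval s) (sval t)), (exist _ _ T0); split=> //.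
- move=> [s Ts] /= o; have [t [m Tt tr]] := truthful_eloise Ts o.
  by exists (exist _ t Tt).
- move=> [s Ts] w /= o m; have [|t tw [Tt tr]] := truthful_abelard Ts _ m.
    by case: eval_owner o.
  by exists (exist _ t Tt).
- move=> r r0 mv tr; apply: (@truthful_play_wins (fun n => sval (r n))) => //.
    by rewrite r0; exact: subform_refl.
  by move=> n; exact: svalP (r n).
Qed.

End TruthToStrategy.

(** * The dual game *)

Section DualGame.
Variables (P : eqType) (phi : form P) (M : edModel P).
Implicit Types (z : eval_pos M) (u v : eval_pos (dual_model M)) (p q : P).

Definition dual_pos z : eval_pos (dual_model M) :=
  match z with
  | At psi x => @At P (dual_model M) (dual psi) x
  | Nbh p U => @Nbh P (dual_model M) p U
  end.

Definition undual_pos u : eval_pos M :=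
  match u with
  | At psi x => @At P M (dual psi) x
  | Nbh p U => @Nbh P M p U
  end.

Lemma undual_posK : cancel undual_pos dual_pos.
Proof. by case=> //= psi x; rewrite dualK. Qed.

Lemma dual_posK : cancel dual_pos undual_pos.
Proof. by case=> //= psi x; rewrite dualK. Qed.

Lemma dual_moves z z' : eval_moves phi z z' ->
  eval_moves (dual phi) (dual_pos z) (dual_pos z').
Proof.
case: z => [[p|p|a b|a b|||a|a|e p a] x|p U] //=; rewrite ?binder_dual.
- by case: binder => [r [U [cU Ux ->]]|//]; exists U.
- by case=> ->; [left|right].
- by case=> ->; [left|right].
- by case=> y xy <-; exists y.
- by case=> y xy <-; exists y.
- by move=> ->.
- by case: binder => [[e a] [y Uy <-]|//]; exists y.
Qed.

Lemma undual_moves u v : eval_moves (dual phi) u v ->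
  eval_moves phi (undual_pos u) (undual_pos v).
Proof.
case: u => [[p|p|a b|a b|||a|a|e p a] x|p U] //=; rewrite ?binder_dual.
- by case: binder => [r [U [cU Ux ->]]|//]; exists U.
- by case=> ->; [left|right].
- by case=> ->; [left|right].
- by case=> y xy <-; exists y.
- by case=> y xy <-; exists y.
- by move=> ->.
- by case: binder => [[e a] [y Uy <-]|//]; exists y; rewrite //= dualK.
Qed.

Lemma undual_owner_abelard u : eval_owner phi (undual_pos u) = Abelard ->
  eval_owner (dual phi) u = Eloise.
Proof.
case: u => [[p|p|a b|a b|||a|a|e p a] x|p U] //=; rewrite ?binder_dual.
- case: binder => [[[] a]|] //=; case: ifPn => //; rewrite in_setE => Vx _.
  by case: ifPn => //; rewrite in_setE.
- case: ifPn => // /negP; rewrite in_setE => Vx _.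
  by case: ifPn => // /negP; rewrite in_setE.
- by case: binder => [[[] a]|].
Qed.

(* Dualizing does not quite exchange the players: both games give Eloise the
   positions at fixpoint formulas, and [Nbh p U] with [p] unbound. *)
Lemma undual_owner_eloise u z z' :
  eval_owner phi (undual_pos u) = Eloise -> eval_owner (dual phi) u = Eloise ->
  eval_moves phi (undual_pos u) z -> eval_moves phi (undual_pos u) z' -> z = z'.
Proof.
case: u => [[p|p|a b|a b|||a|a|e p a] x|p U] //=; rewrite ?binder_dual.
- by case: binder => [[[] a]|].
- by move=> _ _ -> ->.
- by case: binder => [[[] a]|].
Qed.

Lemma certified_undual x (win : set (nat -> eval_pos (dual_model M))) :
  @certified (eval_game (dual phi) (dual_model M)) (dual_pos (At phi x)) Eloise win ->
  @certified (eval_game phi M) (At phi x) Abelard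
    (fun pi => win (dual_pos \o pi)).
Proof.
case=> S [at_ [step [s0 [at0 own opp win_r]]]].
exists S, (undual_pos \o at_), step, s0; split.
- by rewrite /= at0 dual_posK.
- move=> s /undual_owner_abelard/own[s' m st].
  by exists s' => //; exact: undual_moves.
(* A position that both games give to Eloise has at most one move, so the certificate's own choice
   is the given move. Otherwise the dual position is Abelard's, and the certificate answers all his
   moves. *)
- move=> s w /= o m; case o': (eval_owner (dual phi) (at_ s)).
    have [s' m' st] := own _ o'; exists s' => //.
    apply: undual_owner_eloise o' (undual_moves m') m.
    by case: eval_owner o.
  have [||s' e st] := opp s (dual_pos w); first by rewrite /= o'.
    by rewrite -[at_ s]undual_posK; exact: dual_moves.
  by exists s' => //; rewrite e dual_posK.
- move=> r r0 mv st.
  have -> : dual_pos \o ((undual_pos \o at_) \o r) = at_ \o r.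
    by apply: funext => n /=; rewrite undual_posK.
  apply: win_r => // n; rewrite -[at_ (r n)]undual_posK.
  rewrite -[at_ (r n.+1)]undual_posK; exact: dual_moves (mv n).
Qed.

Lemma inf_often_dual pi p :
  bound_inf_often (dual phi) (dual_pos \o pi) p <-> bound_inf_often phi pi p.
Proof.
rewrite /bound_inf_often bound_vars_dual.
have occ z : occurs_at p (dual_pos z) <-> occurs_at p z.
  by case: z => [[]|].
split=> -[bp io]; split=> // n; have [m nm om] := io n; exists m => //.
  exact/occ.
exact/(occ (pi m)).
Qed.

(** A play and its dual image have the same dominant variable, and dualizing flips its operator. *)
Lemma eval_wins_dual_disjoint (phi_clean : clean phi) pi :
  legal_pos phi (pi 0) -> (forall n, eval_moves phi (pi n) (pi n.+1)) ->
  eval_wins phi pi -> ~ eval_wins (dual phi) (dual_pos \o pi).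
Proof.
move=> leg mv; have [p [ip dom _]] := exists_dominant phi_clean leg mv.
move=> /(eval_wins_dominant ip dom)[a pNu].
have ip' : inf_often (dual phi) (dual_pos \o pi) p by apply/inf_often_dual.
move/(eval_wins_dominant ip') => [|b]; last by rewrite binder_dual pNu.
by move=> q /inf_often_dual/dom/dep_le_dual.
Qed.

End DualGame.

Theorem mainTheorem4 (P : eqType) (M : edModel P) (phi : form P)
    (phi_wf : wf_form phi) (phi_clean : clean phi) (x : M) :
  sem phi (valuation M) x <->
  @eloise_has_winning_strategy (eval_game phi M) (At phi x).
Proof.
split=> [sx|win]; first exact/certified_winning_strategy/sem_certified.
apply: contrapT => nsx.
have dsx : sem (M := dual_model M) (dual phi) (valuation (dual_model M)) x.
  (* [dual_model] shares its space and accessibility relation with [M], so the meaning may be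
     computed in [M] under the complemented valuation. *)
  suff : sem (dual phi) (fun p => ~` valuation M p) x by [].
  by rewrite (sem_dual phi_wf (@valuation_clopen _ M)).
have /certified_undual cert := @sem_certified P (dual phi) (dual_model M)
  (etrans (wf_form_dual phi) phi_wf) (etrans (clean_dual phi) phi_clean) x dsx.
have [pi [pi0 mv w w']] := certified_abelard_play cert win.
apply: (@eval_wins_dual_disjoint _ phi M phi_clean pi) w' => //.
by rewrite pi0; exact: subform_refl.
Qed.
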